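(* Let $G$ be a group and let $R$ be a $G$-graded commutative ring. Consider the following statements. (1) $R$ is a pm$^+$ graded ring. (2) If $S\subseteq h(R)$ is a multiplicatively closed subset of $R$, then $R_S$ is a Gelfand graded ring. (3) If $r\in h(R)$ is a non-nilpotent element of $R$, then $R_r$ is a Gelfand graded ring. (4) If $r\in h(R)$ is a non-nilpotent element of $R$, then $D_G(r)$ is a normal space. Then $(1)\Rightarrow(2)\Rightarrow(3)\Rightarrow(4)$. Moreover, if $R$ satisfies condition (PCm) (in particular, if $R$ satisfies condition (Av)), then $(4)\Rightarrow(1)$.
   Context: $G$ is a group with identity $e$. A commutative ring $R$ with unit is $G$-graded if $R=\bigoplus_{g\in G}R_g$ with additive subgroups $R_g$ satisfying $R_gR_{g'}\subseteq R_{gg'}$; $h(R)=\bigcup_{g\in G}R_g$ is the set of homogeneous elements. An ideal $I$ is graded if $I=\bigoplus_{g\in G}(I\cap R_g)$. A homogeneous prime ideal is a graded ideal $P\neq R$ such that for all $r,s\in h(R)$, $rs\in P$ implies $r\in P$ or $s\in P$; $G\mathrm{Spec}(R)$ is the set of these. A graded maximal ideal is a graded ideal that is maximal among proper graded ideals. The Zariski topology on $G\mathrm{Spec}(R)$ has as closed sets the sets $V_G(I)=\{P : I\subseteq P\}$, $I$ a graded ideal. For $r\in h(R)$, $D_G(r)=\{P\in G\mathrm{Spec}(R): r\notin P\}$, with the subspace topology. A topological space is normal if any two disjoint closed subsets have disjoint open neighborhoods (no $T_1$ or Hausdorff assumption). $R$ is a Gelfand ($G$-)graded ring if every homogeneous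 prime ideal is contained in a unique graded maximal ideal. $R$ is a pm$^+$ graded ring if for each $P\in G\mathrm{Spec}(R)$ the homogeneous prime ideals of $R$ containing $P$ form a chain under inclusion. For a multiplicatively closed $S\subseteq h(R)$, $R_S=S^{-1}R$ is $G$-graded by $(S^{-1}R)_g=\{r/s : r\in h(R), s\in S, \deg r=g\deg s\}$; $R_r$ is $R_S$ for $S=\{r^n : n\in\mathbb N\}$. Condition (Av): if $I,J,J'$ are graded ideals of $R$ with $h(R)\cap I\subseteq J\cup J'$, then $I\subseteq J$ or $I\subseteq J'$. Condition (PCm): if $Q,Q'$ are homogeneous prime ideals of $R$ that are not comparable under inclusion, then there exist $g\in G$ and $r,r'\in R_g$ such that $r\in Q\setminus Q'$ and $r'\in Q'\setminus Q$. *)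

(* Defs.v *)
From HB Require Import structures.
From mathcomp Require Import all_boot all_algebra.
From mathcomp Require Import all_classical topology.
From mathcomp Require Import ring.

Set Implicit Arguments.
Unset Strict Implicit.
Unset Printing Implicit Defensive.

Import GRing.Theory.
Local Open Scope classical_set_scope.
Local Open Scope ring_scope.
Local Open Scope quotient_scope.

Section Sums.
Variables (I : choiceType) (R : comPzRingType).

(* The elements of the sum of the subsets B i, i.e. finite sums with at most
   one term from each B i. *)
Definition sum_sets (B : I -> set R) : set R :=
  [set x | exists s : seq I, exists f : I -> R,
     [/\ uniq s, forall i, B i (f i) & x = \sum_(i <- s) f i]].

Definition independent (B : I -> set R) : Prop :=
  forall (s : seq I) (f : I -> R), uniq s -> (forall i, B i (f i)) ->
  \sum_(i <- s) f i = 0 -> forall i, i \in s -> f i = 0.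

Lemma sum_extend (s t : seq I) (f : I -> R) :
  uniq s -> uniq t -> {subset s <= t} ->
  \sum_(i <- t) (if i \in s then f i else 0) = \sum_(i <- s) f i.
Proof.
move=> us ut st; rewrite -big_mkcond -big_filter; apply: perm_big.
apply: uniq_perm; rewrite ?filter_uniq// => i; rewrite mem_filter.
by case: (boolP (i \in s)) => //= /st.
Qed.

End Sums.

(* component A g is the homogeneous component R_g; the last two fields state
   that R is the internal direct sum of these additive subgroups. *)
Record grading (G : groupType) (R : comPzRingType) := Grading {
  component :> G -> set R;
  component0 : forall g, component g 0;
  componentB : forall g x y,
    component g x -> component g y -> component g (x - y);
  componentM : forall g h x y,
    component g x -> component h y -> component (g * h)%g (x * y);
  component_sum : forall x, sum_sets component x;
  component_indep : independent component
}.

Section Graded.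
Variables (G : groupType) (R : comPzRingType) (A : grading G R).

Definition homogeneous : set R := \bigcup_g A g.

Definition is_ideal (I : set R) : Prop :=
  [/\ I 0, forall x y, I x -> I y -> I (x + y) & forall r x, I x -> I (r * x)].

(* The sum of the subgroups I `&` A g is direct by component_indep. *)
Definition graded_ideal (I : set R) : Prop :=
  is_ideal I /\ I `<=` sum_sets (fun g => I `&` A g).

Definition homogeneous_prime (P : set R) : Prop :=
  [/\ graded_ideal P, P <> setT &
      forall r s, homogeneous r -> homogeneous s -> P (r * s) -> P r \/ P s].

Definition graded_maximal (M : set R) : Prop :=
  [/\ graded_ideal M, M <> setT &
      forall I, graded_ideal I -> I <> setT -> M `<=` I -> I = M].

Definition gelfand : Prop :=
  forall P, homogeneous_prime P ->
  exists! M : set R, graded_maximal M /\ P `<=` M.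

Definition pm_plus : Prop :=
  forall P, homogeneous_prime P ->
  forall Q Q', homogeneous_prime Q -> homogeneous_prime Q' ->
  P `<=` Q -> P `<=` Q' -> Q `<=` Q' \/ Q' `<=` Q.

Definition cond_Av : Prop :=
  forall I J J', graded_ideal I -> graded_ideal J -> graded_ideal J' ->
  homogeneous `&` I `<=` J `|` J' -> I `<=` J \/ I `<=` J'.

Definition cond_PCm : Prop :=
  forall Q Q', homogeneous_prime Q -> homogeneous_prime Q' ->
  ~ (Q `<=` Q') -> ~ (Q' `<=` Q) ->
  exists g r r', [/\ A g r, A g r', (Q `\` Q') r & (Q' `\` Q) r'].

Lemma componentN g x : A g x -> A g (- x).
Proof. by move=> Ax; rewrite -sub0r; apply: componentB => //; apply: component0. Qed.

Lemma componentD g x y : A g x -> A g y -> A g (x + y).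
Proof. by move=> Ax Ay; rewrite -[y]opprK; apply/componentB/componentN. Qed.

Lemma decomposition_unique s f s' f' :
  uniq s -> uniq s' -> (forall g, A g (f g)) -> (forall g, A g (f' g)) ->
  \sum_(g <- s) f g = \sum_(g <- s') f' g ->
  forall g, (if g \in s then f g else 0) = (if g \in s' then f' g else 0).
Proof.
move=> us us' Af Af' e g.
pose F g := (if g \in s then f g else 0) - (if g \in s' then f' g else 0).
pose t := undup (g :: s ++ s').
have /(_ g) : forall g, g \in t -> F g = 0.
  apply: (@component_indep _ _ A) => [|h|]; first exact: undup_uniq.
    by apply: componentB; case: ifP => // _; apply: component0.
  rewrite sumrB !sum_extend ?undup_uniq// ?e ?subrr// => h hs;
    by rewrite mem_undup inE mem_cat hs !orbT.
by rewrite mem_undup mem_head => /(_ isT)/subr0_eq.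
Qed.

Lemma component_disjoint g h x : A g x -> A h x -> x != 0 -> g = h.
Proof.
move=> gx hx x0; apply/eqP/negP => /negP gh.
pose f k := if k == g then x else if k == h then x else 0.
have Af k : A k (f k).
  rewrite /f; case: eqP => [->//|_]; case: eqP => [->//|_].
  exact: component0.
have e : \sum_(k <- [:: g]) f k = \sum_(k <- [:: h]) f k.
  by rewrite !big_seq1 /f !eqxx; case: ifP.
have /= := decomposition_unique (isT : uniq [:: g]) (isT : uniq [:: h]) Af Af e g.
by rewrite !inE eqxx (negPf gh) /f eqxx; apply/eqP.
Qed.

Lemma component1 : A 1%g 1.
Proof.
have [s [f [us Af e1]]] := component_sum A 1.
pose e : R := if 1%g \in s then f 1%g else 0.
have Ae : A 1%g e by rewrite /e; case: ifP => // _; apply: component0.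
suff eM x : e * x = x by rewrite -[X in A _ X]eM mulr1.
have eMh h y : A h y -> e * y = y.
  move=> Ay.
  pose f1 k := f (k * h^-1)%g * y; pose f2 k : R := if k == h then y else 0.
  have A1 k : A k (f1 k).
    by rewrite -[k in A k](mulgVK h); apply: componentM.
  have A2 k : A k (f2 k).
    by rewrite /f2; case: eqP => [->//|_]; apply: component0.
  have um : uniq [seq (k * h)%g | k <- s] by rewrite map_inj_uniq//; apply: mulIg.
  have eq12 : \sum_(k <- [seq (k * h)%g | k <- s]) f1 k = \sum_(k <- [:: h]) f2 k.
    rewrite big_map big_seq1 /f2 eqxx -[RHS]mul1r [in RHS]e1 mulr_suml.
    by apply: eq_bigr => k _; rewrite /f1 mulgK.
  have := decomposition_unique um (isT : uniq [:: h]) A1 A2 eq12 h.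
  rewrite inE eqxx /f1 /f2 eqxx mulgV.
  have -> : (h \in [seq (k * h)%g | k <- s]) = (1%g \in s).
    by rewrite -{1}[h]mul1g (mem_map (f := fun k => (k * h)%g))//; apply: mulIg.
  by rewrite /e; case: ifP => //; rewrite mul0r.
have [t [f' [_ Af' ->]]] := component_sum A x.
by rewrite mulr_sumr; apply: eq_bigr => k _; apply: eMh.
Qed.

Lemma homogeneous1 : homogeneous 1.
Proof. by exists 1%g => //; apply: component1. Qed.

Lemma homogeneousM x y : homogeneous x -> homogeneous y -> homogeneous (x * y).
Proof. by move=> [g _ gx] [h _ hy]; exists (g * h)%g => //; apply: componentM. Qed.

Lemma homogeneousX x n : homogeneous x -> homogeneous (x ^+ n).
Proof.
move=> hx; elim: n => [|n IH]; first exact: homogeneous1.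
by rewrite exprS; apply: homogeneousM.
Qed.

Lemma graded_idealP (I : set R) : graded_ideal I -> forall s f,
  uniq s -> (forall g, A g (f g)) -> I (\sum_(g <- s) f g) ->
  forall g, g \in s -> I (f g).
Proof.
move=> [[I0 _ _] gI] s f us Af /gI[s' [f' [us' If' e]]] g gs.
have := decomposition_unique us us' Af (fun g => (If' g).2) e g.
by rewrite gs => ->; case: ifP => // _; have [] := If' g.
Qed.

Lemma graded_bigcap (F : set (set R)) :
  (forall I, F I -> graded_ideal I) -> graded_ideal (\bigcap_(I in F) I).
Proof.
move=> gF; split.
  split=> [I /gF[[]]//|x y Ix Iy I FI|r x Ix I FI].
    by have [[_ + _] _] := gF _ FI; apply; [apply: Ix|apply: Iy].
  by have [[_ _ +] _] := gF _ FI; apply; apply: Ix.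
move=> x Ix; have [s [f [us Af e]]] := component_sum A x.
exists s, (fun g => if g \in s then f g else 0); split => // [g|]; last first.
  by rewrite e big_seq [RHS]big_seq; apply: eq_bigr => g ->.
split; last by case: ifP => // _; apply: component0.
move=> I FI; case: ifP => [gs|_]; last by have [[]] := gF _ FI.
by apply: (graded_idealP (gF _ FI) us Af _ gs); rewrite -e; apply: Ix.
Qed.

Lemma graded_setI I J : graded_ideal I -> graded_ideal J -> graded_ideal (I `&` J).
Proof.
move=> gI gJ; have -> : I `&` J = \bigcap_(K in [set I; J]) K.
  by rewrite bigcap_setU !bigcap_set1.
by apply: graded_bigcap => K [] ->.
Qed.

Lemma graded_setT : graded_ideal setT.
Proof.
split=> // x _; have [s [f [us Af e]]] := component_sum A x.
by exists s, f; split.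
Qed.

Lemma graded_not_sub I J : graded_ideal I -> graded_ideal J -> ~ (I `<=` J) ->
  exists x, [/\ homogeneous x, I x & ~ J x].
Proof.
move=> [_ gI] [[J0 JD _] _] nIJ; apply: contrapT => no; apply: nIJ => x Ix.
have [s [f [_ Af ->]]] := gI _ Ix.
elim: s => [|g s IH]; rewrite ?big_nil ?big_cons//; apply: JD => //.
apply: contrapT => nJ; apply: no; exists (f g).
by have [If Ag] := Af g; split => //; exists g.
Qed.

End Graded.

Section Spectrum.
Variables (G : groupType) (R : comPzRingType) (A : grading G R).

Record GSpec := MkGSpec {
  prime_set :> set R;
  prime_setP : homogeneous_prime A prime_set
}.

HB.instance Definition _ := gen_eqMixin GSpec.
HB.instance Definition _ := gen_choiceMixin GSpec.

Definition VG (I : set R) : set GSpec := [set P : GSpec | I `<=` P].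

Definition DG (r : R) : set GSpec := [set P : GSpec | ~ (P : set R) r].

Definition zariski_open (U : set GSpec) : Prop :=
  exists2 I, graded_ideal A I & U = ~` VG I.

Lemma zariski_openT : zariski_open setT.
Proof.
exists setT; first exact: graded_setT.
rewrite -[LHS]setC0; congr (~` _); apply/seteqP; split=> // P.
by have [_ nT _] := prime_setP P ; rewrite /VG /= subTset => /nT.
Qed.

Lemma zariski_openI : setI_closed zariski_open.
Proof.
move=> _ _ [I gI ->] [J gJ ->]; exists (I `&` J); first exact: graded_setI.
rewrite -setCU; congr (~` _); apply/seteqP; split => [P [] IP x [Ix Jx]|P IJP].
- exact: IP.
- exact: IP.
- have [gP _ pP] := prime_setP P.
  apply: contrapT => /not_orP[nI nJ].
  have [x [hx Ix nx]] := graded_not_sub gI gP nI.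
  have [y [hy Jy ny]] := graded_not_sub gJ gP nJ.
  have [] // : (P : set R) x \/ (P : set R) y.
  have [[_ _ IM] _] := gI; have [[_ _ JM] _] := gJ.
  apply: pP => //; apply: IJP; split; last exact: JM.
  by rewrite mulrC; apply: IM.
Qed.

Lemma zariski_open_bigU (K : Type) (U : K -> set GSpec) :
  (forall k, zariski_open (U k)) -> zariski_open (\bigcup_k U k).
Proof.
move=> oU.
have /choice[J HJ] : forall k, exists I, graded_ideal A I /\ U k = ~` VG I.
  by move=> k; have [I] := oU k; exists I.
exists (\bigcap_(I in [set I | graded_ideal A I /\ forall k, J k `<=` I]) I).
  by apply: graded_bigcap => I [].
rewrite -[LHS]setCK setC_bigcup; congr (~` _); apply/seteqP; split => P.
  move=> PU x; apply; split; first by have [] := prime_setP P.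
  by move=> k; have := PU k I; rewrite (HJ k).2 setCK.
move=> JP k _; rewrite (HJ k).2 setCK => x Jx; apply: JP => I [_ JI].
by apply: JI Jx.
Qed.

HB.instance Definition _ := isOpenTopological.Build GSpec
  zariski_openT zariski_openI zariski_open_bigU.

Lemma zariski_closedE (C : set GSpec) :
  closed C <-> exists2 I, graded_ideal A I & C = VG I.
Proof.
rewrite -openC; split=> -[I gI e]; exists I => //; last by rewrite e.
by rewrite -[LHS]setCK e setCK.
Qed.

End Spectrum.

Arguments VG {G R} A I.
Arguments DG {G R} A r.

(* A mulrClosed predicate contains 1; S may contain 0, and then loc is the zero
   ring. *)
Section Localization.
Variables (R : comPzRingType) (S : mulrClosed R).

Definition loc_pair : Type := (R * {s : R | s \in S})%type.
HB.instance Definition _ := Choice.on loc_pair.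

Definition loc_eq (x y : loc_pair) : bool :=
  `[< exists2 t, t \in S & t * (x.1 * val y.2) = t * (y.1 * val x.2) >].

Lemma loc_eq_refl : reflexive loc_eq.
Proof. by move=> x; apply/asboolP; exists 1; rewrite ?rpred1. Qed.

Lemma loc_eq_sym : symmetric loc_eq.
Proof.
by move=> x y; apply/asboolP/asboolP => -[t tS e]; exists t.
Qed.

Lemma loc_eq_trans : transitive loc_eq.
Proof.
move=> y x z /asboolP[t tS e] /asboolP[u uS e']; apply/asboolP.
exists (t * u * val y.2); first by rewrite !rpredM//; apply: valP.
transitivity (u * val z.2 * (t * (x.1 * val y.2))); first ring.
by rewrite e; transitivity (t * val x.2 * (u * (y.1 * val z.2))); [|rewrite e']; ring.
Qed.

Canonical loc_equiv := EquivRel loc_eq loc_eq_refl loc_eq_sym loc_eq_trans.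

Definition loc : Type := {eq_quot loc_eq}.
HB.instance Definition _ : EqQuotient _ loc_eq loc := EqQuotient.on loc.
HB.instance Definition _ := Choice.on loc.

Definition denom (s : R) (sS : s \in S) : {s : R | s \in S} := exist _ s sS.

Definition loc_frac (r s : R) (sS : s \in S) : loc := \pi_loc (r, denom sS).

Lemma loc_frac_eq r s (sS : s \in S) r' s' (sS' : s' \in S) :
  loc_frac r sS = loc_frac r' sS' <->
  exists2 t, t \in S & t * (r * s') = t * (r' * s).
Proof. by split=> [/eqmodP/asboolP|?]; last apply/eqmodP/asboolP. Qed.

Lemma loc_frac_congr r s (sS : s \in S) r' s' (sS' : s' \in S) :
  r * s' = r' * s -> loc_frac r sS = loc_frac r' sS'.
Proof. by move=> e; apply/loc_frac_eq; exists 1; rewrite ?rpred1 ?e. Qed.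

Lemma loc_fracP (a : loc) : exists r s (sS : s \in S), a = loc_frac r sS.
Proof.
elim/quotW: a => -[r s]; exists r, (val s), (valP s).
by congr (\pi_loc _); congr pair; apply: val_inj.
Qed.

Definition loc_addf (x y : loc_pair) : loc_pair :=
  (x.1 * val y.2 + y.1 * val x.2, denom (rpredM (valP x.2) (valP y.2))).
Definition loc_oppf (x : loc_pair) : loc_pair := (- x.1, x.2).
Definition loc_mulf (x y : loc_pair) : loc_pair :=
  (x.1 * y.1, denom (rpredM (valP x.2) (valP y.2))).

Definition loc_add (a b : loc) : loc := \pi_loc (loc_addf (repr a) (repr b)).
Definition loc_opp (a : loc) : loc := \pi_loc (loc_oppf (repr a)).
Definition loc_mul (a b : loc) : loc := \pi_loc (loc_mulf (repr a) (repr b)).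
Definition loc0 : loc := loc_frac 0 (rpred1 S).
Definition loc1 : loc := loc_frac 1 (rpred1 S).

Lemma loc_reprP (x : loc_pair) :
  exists2 t, t \in S &
    t * ((repr (\pi_loc x)).1 * val x.2) = t * (x.1 * val (repr (\pi_loc x)).2).
Proof.
have e : \pi_loc (repr (\pi_loc x)) = \pi_loc x by rewrite reprK.
by move/eqmodP/asboolP: e.
Qed.

Lemma loc_addE r s (sS : s \in S) r' s' (sS' : s' \in S) :
  loc_add (loc_frac r sS) (loc_frac r' sS') =
  loc_frac (r * s' + r' * s) (rpredM sS sS').
Proof.
rewrite /loc_add /loc_frac; apply/eqmodP/asboolP => /=.
have [t tS] := loc_reprP (r, denom sS); have [u uS] := loc_reprP (r', denom sS').
move: (repr _) (repr _) => [a1 [a2 ?]] [b1 [b2 ?]] /= eb ea.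
exists (t * u); rewrite ?rpredM//.
transitivity (t * (a1 * s) * (u * b2 * s') + u * (b1 * s') * (t * a2 * s)).
  by ring.
by rewrite ea eb; ring.
Qed.

Lemma loc_oppE r s (sS : s \in S) : loc_opp (loc_frac r sS) = loc_frac (- r) sS.
Proof.
rewrite /loc_opp /loc_frac; apply/eqmodP/asboolP => /=.
have [t tS] := loc_reprP (r, denom sS).
move: (repr _) => [a1 [a2 ?]] /= ea; exists t => //.
by rewrite !mulNr !mulrN ea.
Qed.

Lemma loc_mulE r s (sS : s \in S) r' s' (sS' : s' \in S) :
  loc_mul (loc_frac r sS) (loc_frac r' sS') = loc_frac (r * r') (rpredM sS sS').
Proof.
rewrite /loc_mul /loc_frac; apply/eqmodP/asboolP => /=.
have [t tS] := loc_reprP (r, denom sS); have [u uS] := loc_reprP (r', denom sS').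
move: (repr _) (repr _) => [a1 [a2 ?]] [b1 [b2 ?]] /= eb ea.
exists (t * u); rewrite ?rpredM//.
transitivity (t * (a1 * s) * (u * (b1 * s'))); first by ring.
by rewrite ea eb; ring.
Qed.

Lemma loc_addA : associative loc_add.
Proof.
move=> a b c; have [r [s [sS ->]]] := loc_fracP a.
have [r' [s' [sS' ->]]] := loc_fracP b; have [r2 [s2 [sS2 ->]]] := loc_fracP c.
by rewrite !loc_addE; apply: loc_frac_congr; ring.
Qed.

Lemma loc_addC : commutative loc_add.
Proof.
move=> a b; have [r [s [sS ->]]] := loc_fracP a.
by have [r' [s' [sS' ->]]] := loc_fracP b; rewrite !loc_addE; apply: loc_frac_congr; ring.
Qed.

Lemma loc_add0 : left_id loc0 loc_add.
Proof.
by move=> a; have [r [s [sS ->]]] := loc_fracP a; rewrite !loc_addE; apply: loc_frac_congr; ring.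
Qed.

Lemma loc_addN : left_inverse loc0 loc_opp loc_add.
Proof.
move=> a; have [r [s [sS ->]]] := loc_fracP a.
by rewrite loc_oppE !loc_addE; apply: loc_frac_congr; ring.
Qed.

HB.instance Definition _ :=
  GRing.isZmodule.Build loc loc_addA loc_addC loc_add0 loc_addN.

Lemma loc_mulA : associative loc_mul.
Proof.
move=> a b c; have [r [s [sS ->]]] := loc_fracP a.
have [r' [s' [sS' ->]]] := loc_fracP b; have [r2 [s2 [sS2 ->]]] := loc_fracP c.
by rewrite !loc_mulE; apply: loc_frac_congr; ring.
Qed.

Lemma loc_mulC : commutative loc_mul.
Proof.
move=> a b; have [r [s [sS ->]]] := loc_fracP a.
by have [r' [s' [sS' ->]]] := loc_fracP b; rewrite !loc_mulE; apply: loc_frac_congr; ring.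
Qed.

Lemma loc_mul1 : left_id loc1 loc_mul.
Proof.
by move=> a; have [r [s [sS ->]]] := loc_fracP a; rewrite !loc_mulE; apply: loc_frac_congr; ring.
Qed.

Lemma loc_mulDl : left_distributive loc_mul +%R.
Proof.
move=> a b c; rewrite /GRing.add /=; have [r [s [sS ->]]] := loc_fracP a.
have [r' [s' [sS' ->]]] := loc_fracP b; have [r2 [s2 [sS2 ->]]] := loc_fracP c.
by rewrite !(loc_addE, loc_mulE); apply: loc_frac_congr; ring.
Qed.

HB.instance Definition _ := GRing.Zmodule_isComPzRing.Build loc
  loc_mulA loc_mulC loc_mul1 loc_mulDl.

Lemma loc_fracM r s (sS : s \in S) r' s' (sS' : s' \in S) :
  loc_frac r sS * loc_frac r' sS' = loc_frac (r * r') (rpredM sS sS').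
Proof. exact: loc_mulE. Qed.

Lemma loc_fracB r s (sS : s \in S) r' s' (sS' : s' \in S) :
  loc_frac r sS - loc_frac r' sS' =
  loc_frac (r * s' - r' * s) (rpredM sS sS').
Proof. by rewrite -mulNr -loc_addE -loc_oppE. Qed.

Lemma loc_frac_eq0 r s (sS : s \in S) :
  loc_frac r sS = 0 <-> exists2 t, t \in S & t * r = 0.
Proof.
rewrite -[X in _ = X]/(loc_frac 0 (rpred1 S)) loc_frac_eq mul0r mulr1.
by split=> -[t tS e]; exists t => //; rewrite e mulr0.
Qed.

Lemma loc_frac_sum (I : Type) (l : seq I) (f : I -> R) s (sS : s \in S) :
  loc_frac (\sum_(i <- l) f i) sS = \sum_(i <- l) loc_frac (f i) sS.
Proof.
elim: l => [|i l IH].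
  by rewrite !big_nil; apply/loc_frac_eq0; exists 1; rewrite ?rpred1 ?mulr0.
rewrite !big_cons -IH.
rewrite -[RHS]/(loc_add (loc_frac _ _) (loc_frac _ _)) loc_addE.
by apply: loc_frac_congr; ring.
Qed.

End Localization.

Section LocalizationGrading.
Variables (G : groupType) (R : comPzRingType) (A : grading G R).
Variable S : mulrClosed R.
Hypothesis homS : forall s, s \in S -> homogeneous A s.

(* deg r = g * deg s, where 0 has every degree. *)
Definition loc_component (g : G) : set (loc S) :=
  [set a | exists h r s (sS : s \in S),
     [/\ A h s, A (g * h)%g r & a = loc_frac r sS]].

Lemma loc_trivial (a : loc S) : 0 \in S -> a = 0.
Proof.
by have [r [s [sS ->]]] := loc_fracP a => S0; apply/loc_frac_eq0; exists 0; rewrite ?mul0r.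
Qed.

Lemma loc_component0 g : loc_component g 0.
Proof.
exists 1%g, 0, 1, (rpred1 S); split => //; first exact: component1.
exact: component0.
Qed.

Lemma degree_comm h h' s s' : s \in S -> s' \in S -> A h s -> A h' s' ->
  0 \notin S -> (h * h' = h' * h)%g.
Proof.
move=> sS sS' As As' S0; apply: (component_disjoint (A := A) (x := s * s')).
- exact: componentM.
- by rewrite mulrC; apply: componentM.
- by apply: contraNneq S0 => <-; apply: rpredM.
Qed.

Lemma loc_componentB g a b :
  loc_component g a -> loc_component g b -> loc_component g (a - b).
Proof.
have [S0 _ _|S0] := boolP (0 \in S).
  by rewrite (loc_trivial (a - b) S0); apply: loc_component0.
move=> [h [r [s [sS [As Ar ->]]]]] [h' [r' [s' [sS' [As' Ar' ->]]]]].
exists (h * h')%g, (r * s' - r' * s), (s * s'), (rpredM sS sS').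
rewrite loc_fracB; split => //; first exact: componentM.
apply: componentB; first by rewrite mulgA; apply: componentM.
by rewrite (degree_comm sS sS' As As' S0) mulgA; apply: componentM.
Qed.

Lemma loc_componentM g g' a b :
  loc_component g a -> loc_component g' b -> loc_component (g * g')%g (a * b).
Proof.
have [S0 _ _|S0] := boolP (0 \in S).
  by rewrite (loc_trivial (a * b) S0); apply: loc_component0.
move=> [h [r [s [sS [As Ar ->]]]]] [h' [r' [s' [sS' [As' Ar' ->]]]]].
rewrite loc_fracM; have [r's0|r's0] := eqVneq (r' * s) 0.
  rewrite [X in loc_component _ X](_ : _ = 0); first exact: loc_component0.
  by apply/loc_frac_eq0; exists s => //; rewrite mulrC -mulrA r's0 mulr0.
exists (h * h')%g, (r * r'), (s * s'), (rpredM sS sS').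
split=> //; first exact: componentM.
have hh' := degree_comm sS sS' As As' S0.
have e : (g' * h = h * g')%g.
  apply: (mulIg h'); rewrite -mulgA hh' mulgA -[RHS]mulgA.
  apply: (component_disjoint (A := A)) r's0; first exact: componentM.
  by rewrite mulrC; apply: componentM.
have -> : (g * g' * (h * h') = g * h * (g' * h'))%g.
  by rewrite !mulgA; congr (_ * _)%g; rewrite -!mulgA e.
exact: componentM.
Qed.

Lemma loc_component_sum a : sum_sets loc_component a.
Proof.
have [r [s [sS ->]]] := loc_fracP a; have [h _ As] := homS sS.
have [l [f [ul Af ->]]] := component_sum A r.
exists [seq (k * h^-1)%g | k <- l], (fun k => loc_frac (f (k * h)%g) sS); split.
- by rewrite map_inj_uniq//; apply: mulIg.
- by move=> k; exists h, (f (k * h)%g), s, sS.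
- by rewrite big_map loc_frac_sum; apply: eq_bigr => k _; rewrite mulgVK.
Qed.

Lemma loc_common_denominator (l : seq G) (f : G -> loc S) :
  0 \notin S -> (forall g, loc_component g (f g)) ->
  exists h s (sS : s \in S), A h s /\
  forall g, g \in l -> exists2 r, A (g * h)%g r & f g = loc_frac r sS.
Proof.
move=> S0 Af; elim: l => [|g0 l [h [s [sS [As IH]]]]].
  by exists 1%g, 1, (rpred1 S); split => //; apply: component1.
have [h0 [r0 [s0 [sS0 [As0 Ar0 e0]]]]] := Af g0.
exists (h * h0)%g, (s * s0), (rpredM sS sS0); split; first exact: componentM.
move=> g; rewrite inE => /predU1P[->|/IH[r Ar ->]].
  exists (r0 * s); last by rewrite e0; apply: loc_frac_congr; ring.
  by rewrite (degree_comm sS sS0 As As0 S0) mulgA; apply: componentM.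
exists (r * s0); last by apply: loc_frac_congr; ring.
by rewrite mulgA; apply: componentM.
Qed.

Lemma loc_component_indep : independent loc_component.
Proof.
move=> l f ul Af sum0 g gl; have [S0|S0] := boolP (0 \in S); first exact: loc_trivial.
have [h [s [sS [As Hf]]]] := loc_common_denominator l S0 Af.
have /choice[F HF] : forall k, exists r, A (k * h)%g r /\
    (k \in l -> f k = loc_frac r sS).
  move=> k; have [/Hf[r Ar e]|_] := boolP (k \in l); first by exists r.
  by exists 0; split => //; apply: component0.
have /loc_frac_eq0[t tS] : loc_frac (\sum_(k <- l) F k) sS = 0.
  rewrite loc_frac_sum -[RHS]sum0 big_seq [RHS]big_seq.
  by apply: eq_bigr => k /(HF k).2.
have [k _ At] := homS tS; rewrite mulr_sumr => e.
rewrite ((HF g).2 gl); apply/loc_frac_eq0; exists t => //.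
pose F' u := t * F (k^-1 * u * h^-1)%g.
have F'E u : F' (k * (u * h))%g = t * F u by rewrite /F' !mulgA mulVg mul1g mulgK.
rewrite -F'E.
have := @component_indep _ _ A [seq (k * (u * h))%g | u <- l] F'; apply.
- by rewrite map_inj_uniq// => x y /mulgI/mulIg.
- move=> u; rewrite -[u in A u _](mulVKg k) -[(k^-1 * u)%g](mulgVK h).
  by apply: componentM => //; have [] := HF (k^-1 * u * h^-1)%g.
- by rewrite big_map -[RHS]e; apply: eq_bigr => u _; rewrite F'E.
- by apply/mapP; exists g.
Qed.

Definition loc_grading : grading G (loc S) :=
  Grading loc_component0 loc_componentB loc_componentM
    loc_component_sum loc_component_indep.

End LocalizationGrading.

Arguments loc_grading {G R} A {S} homS.

Section Powers.
Variables (R : comPzRingType) (r : R).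

Definition powers : {pred R} := [pred x | `[< exists n, x = r ^+ n >]].

Lemma powers_closed : mulr_closed powers.
Proof.
split=> [|x y]; first by apply/asboolP; exists 0%N.
by move=> /asboolP[n ->] /asboolP[m ->]; apply/asboolP; exists (n + m)%N; rewrite exprD.
Qed.

HB.instance Definition _ := GRing.isMulClosed.Build R powers powers_closed.

Lemma powers_homogeneous (G : groupType) (A : grading G R) :
  homogeneous A r -> forall x, x \in powers -> homogeneous A x.
Proof. by move=> hr x /asboolP[n ->]; apply: homogeneousX. Qed.

End Powers.

(* The library's normal_space (no T1 assumption) in terms of disjoint closed
   sets. *)
Lemma normal_space_closedP (T : topologicalType) : normal_space T <->
  forall B C : set T, closed B -> closed C -> B `&` C = set0 ->
  exists U V, [/\ open U, open V, B `<=` U, C `<=` V & U `&` V = set0].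
Proof.
split=> [nT B C cB cC BC0|sepT B cB W /set_nbhsP[U [oU BU UW]]].
  have [|W /set_nbhsP[U [oU BU UW]] WC] := nT B cB (~` C).
    apply/set_nbhsP; exists (~` C); split => //; first exact: closed_openC.
    by move=> x Bx Cx; have : (B `&` C) x by []; rewrite BC0.
  exists U, (~` closure W); split => //.
  - by apply: closed_openC; apply: closed_closure.
  - by move=> x Cx /WC.
  - by apply/seteqP; split => // x [/UW/subset_closure].
have [|U1 [V1 [oU1 oV1 BU1 UV1 UV0]]] := sepT B (~` U) cB (open_closedC oU).
  by apply/seteqP; split => // x [/BU].
exists U1; first by apply/set_nbhsP; exists U1; split.
move=> x clx; apply: UW; apply: contrapT => /UV1 V1x.
have [y] := clx V1 (open_nbhs_nbhs (conj oV1 V1x)).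
by rewrite UV0.
Qed.

(* Main.v *)
(* (1) => (2): homogeneous primes of a localization are determined by their
   pullbacks to R, so two graded maximal ideals over the same prime are
   comparable, hence equal.
   (3) => (4): disjoint closed sets V(I), V(J) of D_G(r) satisfy r^n = i + j for
   some homogeneous i in I and j in J; in the Gelfand graded ring R_r there are
   then a, b of trivial degree with (1 + a i/r^n)(1 + b j/r^n) = 0, and the two
   numerators define the separating basic open sets.  Working in trivial degree
   keeps the classical argument for pm-rings homogeneous.
   (4) => (1): if r in Q \ Q' and r' in Q' \ Q have the same degree, then V(r)
   and V(r') are disjoint in D_G(r + r'), but the open sets separating them
   would both contain any prime below Q and Q'. *)
Require Import Defs.
From mathcomp Require Import all_boot all_algebra.
From mathcomp Require Import all_classical topology.
From mathcomp Require Import ring.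

Set Implicit Arguments.
Unset Strict Implicit.
Unset Printing Implicit Defensive.

Import GRing.Theory.
Local Open Scope classical_set_scope.
Local Open Scope ring_scope.

(** * Homogeneous components of elements *)

Section HomogeneousPart.
Variables (G : groupType) (R : comPzRingType) (A : grading G R).

(** Quantifying over all decompositions builds their uniqueness into the chosen function, so that
    [hpart] can be computed from any decomposition at hand. *)
Lemma homogeneous_part_exists (x : R) : exists p : G -> R,
  forall s f, uniq s -> (forall g, A g (f g)) -> x = \sum_(g <- s) f g ->
  forall g, p g = if g \in s then f g else 0.
Proof.
have [s [f [us Af e]]] := component_sum A x.
exists (fun g => if g \in s then f g else 0) => s' f' us' Af' e' g.
by apply: (decomposition_unique us us' Af Af'); rewrite -e.
Qed.

Definition hpart (g : G) (x : R) : R := projT1 (cid (homogeneous_part_exists x)) g.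

Lemma hpart_sum s f g : uniq s -> (forall g, A g (f g)) ->
  hpart g (\sum_(g <- s) f g) = if g \in s then f g else 0.
Proof. by move=> us Af; rewrite /hpart; case: cid => p /= /(_ s f us Af)->. Qed.

Lemma hpart_id g x : A g x -> hpart g x = x.
Proof.
move=> Ax; pose f k := if k == g then x else 0.
have Af k : A k (f k) by rewrite /f; case: eqP => [->|_] //; apply: component0.
have {1}-> : x = \sum_(k <- [:: g]) f k by rewrite big_seq1 /f eqxx.
by rewrite hpart_sum// inE /f eqxx.
Qed.

Lemma hpart_component g x : A g (hpart g x).
Proof.
have [s [f [us Af ->]]] := component_sum A x.
by rewrite hpart_sum//; case: ifP => // _; apply: component0.
Qed.

Lemma hpart_decomposition x : exists2 s, uniq s & x = \sum_(g <- s) hpart g x.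
Proof.
have [s [f [us Af e]]] := component_sum A x; exists s => //.
by rewrite {1}e big_seq [RHS]big_seq; apply: eq_bigr => g gs; rewrite e hpart_sum// gs.
Qed.

Lemma hpartD g x y : hpart g (x + y) = hpart g x + hpart g y.
Proof.
have [s [f [us Af ex]]] := component_sum A x.
have [s' [f' [us' Af' ey]]] := component_sum A y.
(* Both decompositions are padded by zero to the common support [t]. *)
pose t := undup (s ++ s').
pose F (u : seq G) (h : G -> R) k := if k \in u then h k else 0.
have AF u h : (forall k, A k (h k)) -> forall k, A k (F u h k).
  by move=> Ah k; rewrite /F; case: ifP => // _; apply: component0.
have -> : x + y = \sum_(k <- t) (F s f k + F s' f' k).
  rewrite big_split /= !sum_extend ?undup_uniq// -?ex -?ey// => k ks;
    by rewrite mem_undup mem_cat ks ?orbT.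
rewrite hpart_sum ?undup_uniq//; last by move=> k; apply: componentD; apply: AF.
rewrite {1}ex {1}ey !hpart_sum// mem_undup mem_cat /F.
by case: (g \in s); case: (g \in s'); rewrite ?addr0.
Qed.

(** Right translation by [h] is injective on degrees, so multiplication by [y] moves the summands of
    [x] without merging any two of them. *)
Lemma hpartM g h x y : A h y -> hpart (g * h)%g (x * y) = hpart g x * y.
Proof.
move=> Ay; have [s [f [us Af ->]]] := component_sum A x.
pose F k := f (k * h^-1)%g * y.
have -> : (\sum_(k <- s) f k) * y = \sum_(k <- [seq (k * h)%g | k <- s]) F k.
  by rewrite mulr_suml big_map; apply: eq_bigr => k _; rewrite /F mulgK.
rewrite hpart_sum.
- rewrite hpart_sum// (mem_map (f := fun k => (k * h)%g)); last exact: mulIg.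
  by rewrite /F mulgK; case: ifP => //; rewrite mul0r.
- by rewrite map_inj_uniq//; apply: mulIg.
- by move=> k; rewrite -[k in A k](mulgVK h); apply: componentM.
Qed.

Lemma graded_hpart I g x : graded_ideal A I -> I x -> I (hpart g x).
Proof.
move=> gI; have [[I0 _ _] _] := gI.
have [s [f [us Af ->]]] := component_sum A x => Ix; rewrite hpart_sum//.
by case: ifP => // /(graded_idealP gI us Af Ix).
Qed.

Lemma graded_idealI I : is_ideal I -> (forall g x, I x -> I (hpart g x)) ->
  graded_ideal A I.
Proof.
move=> iI hI; split => // x Ix; have [s us e] := hpart_decomposition x.
exists s, (hpart ^~ x); split => // g; split; [exact: hI|exact: hpart_component].
Qed.

End HomogeneousPart.

(** * Graded ideals, homogeneous primes and graded maximal ideals *)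

Section GradedIdeals.
Variables (G : groupType) (R : comPzRingType) (A : grading G R).

Definition ideal_sum (I J : set R) : set R :=
  [set x | exists a b, [/\ I a, J b & x = a + b]].

Definition principal (r : R) : set R := [set x | exists c, x = c * r].

Lemma principal_self (r : R) : principal r r.
Proof. by exists 1; rewrite mul1r. Qed.

Lemma graded_sum I J :
  graded_ideal A I -> graded_ideal A J -> graded_ideal A (ideal_sum I J).
Proof.
move=> gI gJ; have [[I0 ID IM] _] := gI; have [[J0 JD JM] _] := gJ.
apply: graded_idealI; first split.
- by exists 0, 0; rewrite addr0.
- move=> _ _ [a [b [Ia Jb ->]]] [a' [b' [Ia' Jb' ->]]].
  by exists (a + a'), (b + b'); split; [apply: ID|apply: JD|rewrite addrACA].
- move=> r _ [a [b [Ia Jb ->]]]; exists (r * a), (r * b).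
  by split; [apply: IM|apply: JM|rewrite mulrDr].
- move=> g _ [a [b [Ia Jb ->]]]; exists (hpart A g a), (hpart A g b).
  by rewrite hpartD; split => //; apply: graded_hpart.
Qed.

Lemma graded_principal r : homogeneous A r -> graded_ideal A (principal r).
Proof.
move=> [h _ Ar]; apply: graded_idealI; first split.
- by exists 0; rewrite mul0r.
- by move=> _ _ [a ->] [b ->]; exists (a + b); rewrite mulrDl.
- by move=> c _ [a ->]; exists (c * a); rewrite mulrA.
- move=> g _ [c ->]; exists (hpart A (g * h^-1)%g c).
  by rewrite -[in LHS](mulgVK h g) hpartM.
Qed.

Lemma graded_set0 : graded_ideal A [set 0].
Proof.
apply: graded_idealI; first split=> //=.
- by move=> x y -> ->; rewrite addr0.
- by move=> r x ->; rewrite mulr0.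
- by move=> g x /= ->; rewrite hpart_id//; apply: component0.
Qed.

Lemma ideal_suml I J : J 0 -> I `<=` ideal_sum I J.
Proof. by move=> J0 x Ix; exists x, 0; rewrite addr0. Qed.

Lemma ideal_sumr I J : I 0 -> J `<=` ideal_sum I J.
Proof. by move=> I0 x Jx; exists 0, x; rewrite add0r. Qed.

(** Taking degree [g] parts of an arbitrary splitting keeps its terms in the two graded ideals. *)
Lemma graded_sum_component I J g x : graded_ideal A I -> graded_ideal A J ->
  A g x -> ideal_sum I J x ->
  exists a b, [/\ I a, J b, A g a, A g b & x = a + b].
Proof.
move=> gI gJ Ax [a [b [Ia Jb e]]]; exists (hpart A g a), (hpart A g b).
split; [exact: graded_hpart|exact: graded_hpart|exact: hpart_component..|].
by rewrite -hpartD -e hpart_id.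
Qed.

Lemma ideal_properP (I : set R) : is_ideal I -> I <> setT <-> ~ I 1.
Proof.
move=> [_ _ IM]; split=> [nT I1|nI1 IT]; last by apply: nI1; rewrite IT.
by apply: nT; apply/seteqP; split => // x _; rewrite -[x]mulr1; apply: IM.
Qed.

Lemma homogeneous_prime_not1 P : homogeneous_prime A P -> ~ P 1.
Proof. by move=> [[iP _] nT _]; apply/ideal_properP. Qed.

Lemma homogeneous_primeX P r n :
  homogeneous_prime A P -> homogeneous A r -> P (r ^+ n) -> P r.
Proof.
move=> pP hr; elim: n => [/(homogeneous_prime_not1 pP)//|n IH].
by rewrite exprS; have [_ _ +] := pP => /(_ _ _ hr (homogeneousX n hr))/[apply] -[].
Qed.

Lemma exists_maximal_disjoint (I S : set R) :
  graded_ideal A I -> I `&` S = set0 ->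
  exists P, [/\ graded_ideal A P, I `<=` P, P `&` S = set0 &
    forall K, graded_ideal A K -> P `<=` K -> K `&` S = set0 -> K = P].
Proof.
move=> gI IS0.
(* Adjoining [I] to every candidate lets the union of the empty chain, [set0], satisfy the
   predicate, as this form of Zorn's lemma demands. *)
pose Q X := graded_ideal A (I `|` X) /\ (I `|` X) `&` S = set0.
have [F FQ totF|X [[gX XS0] maxX]] := @Zorn_bigcup R Q.
  have [[X0 FX0]|F0] := pselect (exists X, F X); last first.
    suff -> : \bigcup_(X in F) X = set0 by rewrite /Q setU0.
    by apply/seteqP; split => // x [X FX _]; apply: F0; exists X.
  have e : I `|` \bigcup_(X in F) X = \bigcup_(X in F) (I `|` X).
    apply/seteqP; split => [x [Ix|[X FX Xx]]|x [X FX [Ix|Xx]]].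
    - by exists X0 => //; left.
    - by exists X => //; right.
    - by left.
    - by right; exists X.
  rewrite /Q e; split; last first.
    by apply/seteqP; split => // x [[X /FQ[_ <-] ? ?]].
  apply: graded_idealI; first split.
  - by exists X0 => //; have [[[]]] := FQ _ FX0.
  - move=> x y [X FX Xx] [Y FY Yy].
    have [XY|YX] := totF _ _ FX FY.
      exists Y => //; have [[[_ + _] _] _] := FQ _ FY; apply => //.
      by case: Xx; [left|right; apply: XY].
    exists X => //; have [[[_ + _] _] _] := FQ _ FX; apply => //.
    by case: Yy; [left|right; apply: YX].
  - move=> r x [X FX Xx]; exists X => //.
    by have [[[_ _ +] _] _] := FQ _ FX; apply.
  - move=> g x [X FX Xx]; exists X => //.
    by have [gX _] := FQ _ FX; apply: graded_hpart.
exists (I `|` X); split => // K gK XK KS0.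
have XsubK : X `<=` K by move=> x Xx; apply: XK; right.
have IK : I `|` K = K by apply/setUidPr => x Ix; apply: XK; left.
apply: contrapT => neq; apply: (maxX K); last by rewrite /Q IK.
split=> // KX; apply: neq; apply/seteqP; split => // x /KX; by right.
Qed.

(** Krull's argument: adjoining a homogeneous element outside [P] gives a larger graded ideal, which
    must meet [S]. If the product of two such elements were in [P], multiplying the two elements of
    [S] so obtained would give an element of both [P] and [S]. *)
Lemma maximal_disjoint_prime (P S : set R) :
  graded_ideal A P -> S 1 -> (forall x y, S x -> S y -> S (x * y)) ->
  P `&` S = set0 ->
  (forall K, graded_ideal A K -> P `<=` K -> K `&` S = set0 -> K = P) ->
  homogeneous_prime A P.
Proof.
move=> gP S1 SM PS0 maxP; have [[P0 PD PM] _] := gP.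
have nS x : P x -> ~ S x by move=> Px Sx; have : (P `&` S) x by []; rewrite PS0.
split=> //; first by move=> PT; apply: (nS 1); rewrite ?PT.
have meet r : homogeneous A r -> ~ P r -> exists p c, P p /\ S (p + c * r).
  move=> hr nPr; apply: contrapT => no; apply: nPr.
  rewrite -(maxP (ideal_sum P (principal r))).
  - by apply: ideal_sumr => //; apply: principal_self.
  - by apply: graded_sum => //; apply: graded_principal.
  - by apply: ideal_suml; exists 0; rewrite mul0r.
  - apply/seteqP; split => // x [[p [_ [Pp [c ->] ->]]] Sx].
    by apply: no; exists p, c.
move=> r s hr hs Prs; apply: contrapT => /not_orP[nr ns].
have [p [c [Pp Sp]]] := meet r hr nr; have [q [d [Pq Sq]]] := meet s hs ns.
apply: (nS _ _ (SM _ _ Sp Sq)).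
have -> : (p + c * r) * (q + d * s) = (q + d * s) * p + c * r * q + c * d * (r * s).
  by ring.
by do 2?apply: (PD); apply: (PM).
Qed.

Lemma exists_prime_disjoint (I S : set R) :
  graded_ideal A I -> S 1 -> (forall x y, S x -> S y -> S (x * y)) ->
  I `&` S = set0 ->
  exists P, [/\ homogeneous_prime A P, I `<=` P & P `&` S = set0].
Proof.
move=> gI S1 SM /(exists_maximal_disjoint gI)[P [gP IP PS0 maxP]].
by exists P; split=> //; apply: maximal_disjoint_prime PS0 maxP.
Qed.

(** An ideal is proper exactly when it avoids [1], so this is maximality with respect to
    disjointness from [[set 1]]. *)
Lemma exists_graded_maximal I : graded_ideal A I -> ~ I 1 ->
  exists2 M, graded_maximal A M & I `<=` M.
Proof.
move=> gI nI1.
have proper K : ~ K 1 <-> K `&` [set 1 : R] = set0.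
  split=> [nK|K0 K1]; first by apply/seteqP; split => // x [+ xE]; rewrite xE.
  by have : (K `&` [set 1]) 1 by []; rewrite K0.
have [M [gM IM /proper M1 maxM]] := exists_maximal_disjoint gI ((proper _).1 nI1).
exists M => //; split => //; first by apply/ideal_properP => //; have [] := gM.
move=> K gK nT MK; apply: maxM => //; apply/proper/ideal_properP => //.
by have [] := gK.
Qed.

Lemma graded_maximal_prime M : graded_maximal A M -> homogeneous_prime A M.
Proof.
move=> [gM nT maxM]; have [iM _] := gM.
apply: (@maximal_disjoint_prime M [set 1]) => //.
- by move=> x y -> ->; rewrite mulr1.
- apply/seteqP; split => // x [+ xE]; rewrite xE.
  exact: (ideal_properP iM).1.
move=> K gK MK K0; apply: maxM => //; apply/ideal_properP; first by have [] := gK.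
by move=> K1; have : (K `&` [set 1]) 1 by []; rewrite K0.
Qed.

(* The elements [(1 + a i)(1 + b j)] with [a, b] of trivial degree form a
   multiplicative set; a prime avoiding it could be enlarged to a maximal ideal
   containing [i] and to one containing [j], and these are different. *)
Lemma gelfand_comaximal i j :
  gelfand A -> A 1%g i -> A 1%g j -> i + j = 1 ->
  exists a b, [/\ A 1%g a, A 1%g b & (1 + a * i) * (1 + b * j) = 0].
Proof.
move=> gelA Ai Aj ij1.
pose S := [set x | exists a b, [/\ A 1%g a, A 1%g b & x = (1 + a * i) * (1 + b * j)]].
suff S0 : S 0 by have [a [b [Aa Ab e]]] := S0; exists a, b.
apply: contrapT => nS0.
have AM x y : A 1%g x -> A 1%g y -> A 1%g (x * y).
  by move=> Ax Ay; rewrite -[1%g]mulg1; apply: componentM.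
have S1 : S 1.
  by exists 0, 0; rewrite !mul0r addr0 mulr1; split => //; apply: component0.
have SM x y : S x -> S y -> S (x * y).
  move=> [a [b [Aa Ab ->]]] [a' [b' [Aa' Ab' ->]]].
  exists (a + a' + a * a' * i), (b + b' + b * b' * j); split; last by ring.
  - by apply: componentD; [apply: componentD|apply: (AM) => //; apply: AM].
  - by apply: componentD; [apply: componentD|apply: (AM) => //; apply: AM].
have [|P [pP _ PS0]] := exists_prime_disjoint graded_set0 S1 SM.
  by apply/seteqP; split => // x [+ +]; rewrite /= => ->.
have [gP _ _] := pP; have [[P0 _ _] _] := gP.
have nPS x : P x -> ~ S x by move=> Px Sx; have : (P `&` S) x by []; rewrite PS0.
(* If [1 = p + c * k] with [p] in [P], the trivial-degree part of this equation puts [1 - c' * k] in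
   both [P] and [S], where [c'] is the trivial-degree part of [c]. *)
have enlarge k : A 1%g k -> (forall c, A 1%g c -> S (1 + c * k)) ->
    exists M, [/\ graded_maximal A M, P `<=` M & M k].
  move=> Ak Sk; have hk : homogeneous A k by exists 1%g.
  have gk := graded_principal hk.
  have [|/(exists_graded_maximal (graded_sum gP gk))[M mM PM]] :=
      pselect (ideal_sum P (principal k) 1); last first.
    exists M; split => //.
      by move=> x Px; apply: PM; apply: (ideal_suml _ Px); exists 0; rewrite mul0r.
    by apply: PM; apply: ideal_sumr => //; apply: principal_self.
  move=> [p [_ [Pp [c ->] e]]]; exfalso.
  apply: (nPS (hpart A 1%g p)); first exact: graded_hpart.
  have e1 : 1 = hpart A 1%g p + hpart A 1%g c * k.
    by rewrite -(@hpartM _ _ _ _ 1%g) ?mulg1// -hpartD -e hpart_id//; apply: component1.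
  have -> : hpart A 1%g p = 1 + (- hpart A 1%g c) * k.
    by rewrite {1}e1 mulNr addrK.
  by apply: Sk; apply: componentN; apply: hpart_component.
have [c Ac|M [mM PM Mi]] := enlarge i Ai.
  by exists c, 0; rewrite mul0r addr0 mulr1; split => //; apply: component0.
have [c Ac|M' [mM' PM' M'j]] := enlarge j Aj.
  by exists 0, c; rewrite mul0r addr0 mul1r; split => //; apply: component0.
(* Both maximal ideals lie above [P], so they coincide and contain [i + j = 1]. *)
have [N [_ uniqN]] := gelA _ pP.
have eM : M = M' by rewrite -(uniqN M)// -(uniqN M').
have pM := graded_maximal_prime mM; apply: (homogeneous_prime_not1 pM).
by have [[[_ MD _] _] _ _] := pM; rewrite -ij1; apply: MD => //; rewrite eM.
Qed.

(** Condition (Av) is applied to [Q + Q']. A homogeneous element of it is [a + b] with [a] in [Q]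
    and [b] in [Q'] of the same degree; if no such pair witnesses (PCm), one of the two lies in both
    primes, so the sum lies in [Q] or [Q']. Then [Q + Q'] is inside one of them, against
    incomparability. *)
Lemma cond_Av_PCm : cond_Av A -> cond_PCm A.
Proof.
move=> av Q Q' [gQ _ _] [gQ' _ _] nQQ' nQ'Q; apply: contrapT => no.
have [[Q0 QD _] _] := gQ; have [[Q'0 Q'D _] _] := gQ'.
have [||] // := av _ _ _ (graded_sum gQ gQ') gQ gQ'; last 2 first.
- by move=> QQ'; apply: nQ'Q => x Q'x; apply: QQ'; apply: ideal_sumr.
- by move=> QQ'; apply: nQQ' => x Qx; apply: QQ'; apply: ideal_suml.
move=> x [[g _ Ax] /(graded_sum_component gQ gQ' Ax)[a [b [Qa Q'b Aa Ab ->]]]].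
have [Q'a|nQ'a] := pselect (Q' a); first by right; apply: Q'D.
have [Qb|nQb] := pselect (Q b); first by left; apply: QD.
by exfalso; apply: no; exists g, a, b.
Qed.

End GradedIdeals.

(** * Pulling back homogeneous primes along a localization *)

Section LocalizationPullback.
Variables (G : groupType) (R : comPzRingType) (A : grading G R).
Variable S : mulrClosed R.
Hypothesis homS : forall s, s \in S -> homogeneous A s.
Let AS := loc_grading A homS.

Definition loc_pullback (I : set (loc S)) : set R :=
  [set x | I (loc_frac x (rpred1 S))].

Lemma loc_component_frac1 g x : A g x -> AS g (loc_frac x (rpred1 S)).
Proof.
by move=> Ax; exists 1%g, x, 1, (rpred1 S); rewrite mulg1; split => //; apply: component1.
Qed.

Lemma loc_fracD x s (sS : s \in S) y t (tS : t \in S) :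
  loc_frac x sS + loc_frac y tS = loc_frac (x * t + y * s) (rpredM sS tS).
Proof. exact: loc_addE. Qed.

Lemma loc_frac_add1 x s (sS : s \in S) : 1 + loc_frac x sS = loc_frac (s + x) sS.
Proof.
rewrite -[1]/(loc_frac 1 (rpred1 S)) loc_fracD.
by apply: loc_frac_congr; ring.
Qed.

Lemma loc_frac_split x s (sS : s \in S) :
  loc_frac x sS = loc_frac 1 sS * loc_frac x (rpred1 S).
Proof. by rewrite loc_fracM; apply: loc_frac_congr; ring. Qed.

(** Denominators are units of the localization, so only the numerator matters. *)
Lemma loc_pullbackP I x s (sS : s \in S) : is_ideal I ->
  I (loc_frac x sS) <-> loc_pullback I x.
Proof.
move=> [_ _ IM]; split=> [/(IM (loc_frac s (rpred1 S)))|/(IM (loc_frac 1 sS))].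
  by rewrite /loc_pullback /= loc_fracM; congr I; apply: loc_frac_congr; ring.
by rewrite -loc_frac_split.
Qed.

Lemma loc_pullback_sub I J : is_ideal I -> is_ideal J ->
  loc_pullback I `<=` loc_pullback J -> I `<=` J.
Proof.
move=> iI iJ IJ a; have [x [s [sS ->]]] := loc_fracP a.
by move=> /(loc_pullbackP _ _ iI)/IJ Jx; apply/(loc_pullbackP _ _ iJ).
Qed.

Lemma loc_pullback_prime P : homogeneous_prime AS P ->
  homogeneous_prime A (loc_pullback P).
Proof.
move=> pP; have [gP nT PP] := pP; have [[P0 PD PM] _] := gP.
have fracM1 x y : loc_frac (x * y) (rpred1 S) =
    loc_frac x (rpred1 S) * loc_frac y (rpred1 S).
  by rewrite loc_fracM; apply: loc_frac_congr; ring.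
have iP : is_ideal (loc_pullback P).
  split; first exact: P0.
  - move=> x y Px Py; rewrite /loc_pullback /=.
    suff -> : loc_frac (x + y) (rpred1 S) =
      loc_frac x (rpred1 S) + loc_frac y (rpred1 S) by apply: PD.
    by rewrite loc_fracD; apply: loc_frac_congr; ring.
  - by move=> r x Px; rewrite /loc_pullback /= fracM1; apply: PM.
split.
- apply: graded_idealI => // g x; rewrite /loc_pullback /= => Px.
  have [s us e] := hpart_decomposition A x.
  (* The map from [x] to [x/1] preserves degrees, hence commutes with homogeneous parts. *)
  rewrite (_ : loc_frac (hpart A g x) _ = hpart AS g (loc_frac x (rpred1 S))).
    exact: graded_hpart.
  have ASh k : AS k (loc_frac (hpart A k x) (rpred1 S)).
    by apply: loc_component_frac1; apply: hpart_component.
  rewrite [in RHS]e loc_frac_sum hpart_sum//.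
  rewrite {1}e hpart_sum//; last by move=> k; apply: hpart_component.
  by case: ifP.
- by apply/ideal_properP => //; apply: homogeneous_prime_not1 pP.
- move=> r s [g _ Ar] [h _ As]; rewrite /loc_pullback /= fracM1.
  by apply: PP; [exists g|exists h] => //; apply: loc_component_frac1.
Qed.

Lemma pm_plus_gelfand_loc : pm_plus A -> gelfand AS.
Proof.
move=> pmA P pP; have [gP _ _] := pP.
have [M mM PM] := exists_graded_maximal gP (homogeneous_prime_not1 pP).
exists M; split => // M' [mM' PM'].
have pM := graded_maximal_prime mM; have pM' := graded_maximal_prime mM'.
have [gM MT maxM] := mM; have [gM' MT' maxM'] := mM'.
have [[iM _] [iM' _]] := (gM, gM').
have sub N : P `<=` N -> loc_pullback P `<=` loc_pullback N.
  by move=> PN x; apply: PN.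
have [] := pmA _ (loc_pullback_prime pP) _ _
  (loc_pullback_prime pM) (loc_pullback_prime pM') (sub _ PM) (sub _ PM').
- by move=> /(loc_pullback_sub iM iM')/maxM->.
- by move=> /(loc_pullback_sub iM' iM)/maxM'->.
Qed.

End LocalizationPullback.

(** * The subspace [DG A r] and its normality *)

Section Subspace.
Variables (G : groupType) (R : comPzRingType) (A : grading G R) (r : R).

Definition DG_point (P : GSpec A) (DP : DG A r P) : DG A r :=
  exist _ P (mem_set DP).

Lemma closed_DGP (B : set (DG A r)) : closed B <->
  exists2 I, graded_ideal A I & B = set_val @^-1` VG A I.
Proof.
rewrite -openC; split=> [[_ [I gI ->] e]|[I gI ->]].
  exists I => //; rewrite -[LHS]setCK -e; apply/seteqP.
  by split=> x /=; rewrite /setC /= notE.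
by exists (~` VG A I) => //; exists I.
Qed.

(** The complement of [U] is cut out by a graded ideal, and a prime below [Q] contains no ideal that
    [Q] does not. *)
Lemma open_DG_generization (U : set (DG A r)) (P Q : DG A r) :
  open U -> (set_val P : set R) `<=` (set_val Q : set R) -> U Q -> U P.
Proof.
move=> [_ [I gI ->] <-] PQ UQ IP; apply: UQ => x Ix; apply: PQ; exact: IP.
Qed.

Lemma open_DGI s : homogeneous A s ->
  open (set_val @^-1` DG A s : set (DG A r)).
Proof.
move=> hs; rewrite -[X in open X]setCK openC; apply/closed_DGP.
exists (principal s); first exact: graded_principal.
apply/seteqP; split=> P /=; rewrite /DG /VG /setC /= notE.
  have [[[_ _ PM] _] _ _] := prime_setP (set_val P).
  by move=> Ps _ [c ->]; apply: PM.
by apply; apply: principal_self.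
Qed.

Lemma powers_notin (P : DG A r) s :
  homogeneous A r -> s \in powers r -> ~ (set_val P : set R) s.
Proof.
move=> hr /asboolP[n ->] /(homogeneous_primeX (prime_setP _) hr).
exact: (set_mem (valP P)).
Qed.

(* As [I] and [J] are not both contained in a prime avoiding [r], some power of
   [r] lies in [I + J], which makes [I] and [J] comaximal in degree [1] of the
   localization. *)
Lemma gelfand_normal (hr : homogeneous A r) :
  gelfand (loc_grading A (powers_homogeneous hr)) -> normal_space (DG A r).
Proof.
move=> gelA; apply/normal_space_closedP => _ _ /closed_DGP[I gI ->] /closed_DGP[J gJ ->] IJ0.
have gIJ := graded_sum gI gJ; have [[I0 _ _] _] := gI; have [[J0 _ _] _] := gJ.
have [q qS IJq] : exists2 q, q \in powers r & ideal_sum I J q.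
  apply: contrapT => no.
  have [|x y xS yS||P [pP IJP PS0]] := @exists_prime_disjoint _ _ A _
      [set` powers r] gIJ.
  - exact: rpred1.
  - exact: rpredM.
  - by apply/seteqP; split => // x [IJx xS]; apply: no; exists x.
  have nPr : DG A r (MkGSpec pP).
    move=> /= Pr; have : (P `&` [set` powers r]) r.
      by split=> //=; apply/asboolP; exists 1%N.
    by rewrite PS0.
  suff : (set_val @^-1` VG A I `&` set_val @^-1` VG A J : set (DG A r))
      (DG_point nPr) by rewrite IJ0.
  split=> x Ix; apply: IJP; [exact: ideal_suml Ix|exact: ideal_sumr Ix].
have [k _ Aq] := powers_homogeneous hr qS.
have [i [j [Ii Jj Ai Aj e]]] := graded_sum_component gI gJ Aq IJq.
have A1 x : A k x -> loc_grading A (powers_homogeneous hr) 1%g (loc_frac x qS).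
  by move=> Ax; exists k, x, q, qS; rewrite mul1g.
have [|_ [_ [[h [x [s [sS [As Ax ->]]]]] [h' [y [t [tS [At Ay ->]]]]]]]] :=
  gelfand_comaximal gelA (A1 _ Ai) (A1 _ Aj).
  rewrite loc_fracD -[RHS]/(loc_frac 1 (rpred1 _)).
  by apply: loc_frac_congr; rewrite e; ring.
rewrite (loc_fracM x) (loc_fracM y) (loc_frac_add1 (x * i)) (loc_frac_add1 (y * j)).
move: (rpredM sS qS) (rpredM tS qS) => sqS tqS.
(* A fraction vanishes when a power [w] of [r] kills its numerator, here the product of the two
   numerators. *)
rewrite (loc_fracM (s * q + x * i)) => /loc_frac_eq0[w wS uv0].
have hom z p l g : A g p -> A (1 * g)%g z -> A k l -> homogeneous A (p * q + z * l).
  rewrite mul1g => Ap Az Al; exists (g * k)%g => //.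
  by apply: componentD; apply: componentM.
(* A prime containing [l] and [p * q + z * l] would contain [p * q], a power of [r]. *)
have notin (P : DG A r) K z p l : is_ideal K -> p \in powers r ->
    K `<=` (set_val P : set R) -> K l -> ~ (set_val P : set R) (p * q + z * l).
  move=> [_ _ KM] pS KP Kl Pu.
  apply: (@powers_notin P (p * q) hr); first exact: rpredM.
  have [[[_ PD PM] _] _ _] := prime_setP (set_val P).
  rewrite (_ : p * q = p * q + z * l + (- z) * l); last by ring.
  by apply: PD => //; apply: PM; apply: KP.
have hu := hom _ _ _ _ As Ax Ai; have hv := hom _ _ _ _ At Ay Aj.
exists (set_val @^-1` DG A (s * q + x * i)), (set_val @^-1` DG A (t * q + y * j)).
split.
- exact: open_DGI.
- exact: open_DGI.
- by move=> P IP; apply: notin Ii => //; case: gI.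
- by move=> P JP; apply: notin Jj => //; case: gJ.
(* The prime [P] contains [0], the product of [w] and the two numerators, but [w] is a power of [r],
   so [P] contains one of the numerators. *)
- apply/seteqP; split=> // P [/= nPu nPv].
  have [[[P0 _ _] _] _ PP] := prime_setP (set_val P).
  have hw := powers_homogeneous hr wS.
  have [|/(powers_notin hr wS)|/(PP _ _ hu hv)[]] // := PP _ _ hw (homogeneousM hu hv).
  by rewrite uv0.
Qed.

End Subspace.

(* Two incomparable primes above [P] are separated in [D_G(r + r')], although
   both specialize [P]. *)
Lemma normal_pm_plus (G : groupType) (R : comPzRingType) (A : grading G R) :
  cond_PCm A ->
  (forall r, homogeneous A r -> (forall n, r ^+ n <> 0) -> normal_space (DG A r)) ->
  pm_plus A.
Proof.
move=> pc nor P pP Q Q' pQ pQ' PQ PQ'; apply: contrapT => /not_orP[nQQ' nQ'Q].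
have [g [r [r' [Ar Ar' [Qr nQ'r] [Q'r' nQr']]]]] := pc _ _ pQ pQ' nQQ' nQ'Q.
have hr : homogeneous A r by exists g.
have hr' : homogeneous A r' by exists g.
(* The common degree provided by (PCm) is what makes the sum homogeneous. *)
have hrr : homogeneous A (r + r') by exists g => //; apply: componentD.
have cancel K x y : homogeneous_prime A K -> K x -> K (x + y) -> K y.
  move=> [[[_ KD KM] _] _ _] Kx Kxy.
  by rewrite -[y](addKr x) -mulN1r; apply: KD => //; apply: KM.
have DQ : DG A (r + r') (MkGSpec pQ) by move=> /(cancel _ _ _ pQ Qr).
have DQ' : DG A (r + r') (MkGSpec pQ').
  by rewrite /DG /= addrC => /(cancel _ _ _ pQ' Q'r').
have DP : DG A (r + r') (MkGSpec pP) by move=> /= Prr; apply: DQ; apply: PQ.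
have nnil n : (r + r') ^+ n <> 0.
  move=> rr0; apply: DQ => /=; apply: (homogeneous_primeX (n := n) pQ hrr).
  by rewrite rr0; have [[[]]] := pQ.
pose B x : set (DG A (r + r')) := set_val @^-1` VG A (principal x).
have cB x : homogeneous A x -> closed (B x).
  by move=> hx; apply/closed_DGP; exists (principal x) => //; apply: graded_principal.
have [|U [V [oU oV BU BV UV0]]] :=
  (normal_space_closedP _).1 (nor _ hrr nnil) _ _ (cB _ hr) (cB _ hr').
  (* A prime containing both [r] and [r'] contains [r + r'], so it is not a point of the
     subspace. *)
  apply/seteqP; split=> // K [Kr Kr'].
  apply: (set_mem (valP K)).
  have [[[_ KD _] _] _ _] := prime_setP (set_val K).
  by apply: KD; [apply: Kr|apply: Kr']; apply: principal_self.
have inB K (pK : homogeneous_prime A K) DK x : K x -> B x (@DG_point _ _ _ _ (MkGSpec pK) DK).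
  by move=> Kx _ [c ->]; have [[[_ _ KM] _] _ _] := pK; apply: KM.
suff : (U `&` V) (DG_point DP) by rewrite UV0.
split.
- by apply: (open_DG_generization (Q := DG_point DQ)) => //; apply: BU; apply: inB.
- by apply: (open_DG_generization (Q := DG_point DQ')) => //; apply: BV; apply: inB.
Qed.

Theorem theorem3p9 (G : groupType) (R : comPzRingType) (A : grading G R) :
  let st1 := pm_plus A in
  let st2 := forall (S : mulrClosed R)
    (hS : forall s, s \in S -> homogeneous A s), gelfand (loc_grading A hS) in
  let st3 := forall (r : R) (hr : homogeneous A r),
    (forall n, r ^+ n <> 0) -> gelfand (loc_grading A (powers_homogeneous hr)) in
  let st4 := forall r : R, homogeneous A r ->
    (forall n, r ^+ n <> 0) -> normal_space (DG A r) in
  [/\ st1 -> st2, st2 -> st3, st3 -> st4, cond_Av A -> cond_PCm A &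
      cond_PCm A -> st4 -> st1].
Proof.
split.
- by move=> pmA S hS; apply: pm_plus_gelfand_loc.
- by move=> gelA r hr _; apply: gelA.
- by move=> gelA r hr nnil; apply: gelfand_normal (gelA r hr nnil).
- exact: cond_Av_PCm.
- exact: normal_pm_plus.
Qed.
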